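(* Let $\star$ be a star product on $C^\infty(U)$, $U$ a coordinate chart of an $n$-dimensional manifold, with a noncommutative $\star$-metric. Suppose that the left (resp. right) quasi-connection ${}^\star\nabla$ (resp. ${}^\star\tilde\nabla$) is torsion free, i.e. ${}^\star\nabla_iE_j={}^\star\nabla_jE_i$ (resp. ${}^\star\tilde\nabla_i\tilde E_j={}^\star\tilde\nabla_j\tilde E_i$) for all $i,j$. Then the first (algebraic) Bianchi identity $${}^\star\mathcal{R}_{E_iE_j}E_k+{}^\star\mathcal{R}_{E_jE_k}E_i+{}^\star\mathcal{R}_{E_kE_i}E_j=0$$ $$\big(\text{resp. } {}^\star\tilde{\mathcal{R}}_{\tilde E_i\tilde E_j}\tilde E_k+{}^\star\tilde{\mathcal{R}}_{\tilde E_j\tilde E_k}\tilde E_i+{}^\star\tilde{\mathcal{R}}_{\tilde E_k\tilde E_i}\tilde E_j=0\big)$$ holds for $1\le i,j,k\le n$.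
   Context: $U$ has coordinates $x^1,\dots,x^n$; $\mathcal{A}_U=C^\infty(U)[[\hbar]]$ with real smooth coefficients. A star product is an associative $\mathbb{R}[[\hbar]]$-bilinear product $\star$ on $\mathcal{A}_U$ such that for $u,v\in C^\infty(U)$: $1\star u=u\star1=u$ and $u\star v=uv+\sum_{q\ge1}B_q(u,v)\hbar^q$ with $B_q:C^\infty(U)\times C^\infty(U)\to C^\infty(U)$ bi-differential operators. (The derivations $\partial_i$ need not satisfy the Leibniz rule for $\star$.) ${}^\star\mathcal{T}_U$ (resp. ${}^\star\tilde{\mathcal{T}}_U$) is the free left (resp. right) $(\mathcal{A}_U,\star)$-module with basis $E_1,\dots,E_n$ (resp. $\tilde E_1,\dots,\tilde E_n$), $E_i=\tilde E_i=\partial_i$. A $\star$-metric ${}^\star g:{}^\star\mathcal{T}_U\otimes_{\mathbb{R}[[\hbar]]}{}^\star\tilde{\mathcal{T}}_U\to\mathcal{A}_U$ is a two-sided $(\mathcal{A}_U,\star)$-module homomorphism with $({}^\star g(E_i,\tilde E_j))$ $\star$-invertible; the modules ${}^\star\mathcal{T}^*_U$ (free left, basis $E^i$) and ${}^\star\tilde{\mathcal{T}}^*_U$ (free right, basis $\tilde E^i$) are the $\star$-cotangent bundles, with dual bases: ${}^\star g(E^i,\tilde E_j)={}^\star g(E_j,\tilde E^i)=\delta^i_j$. A left quasi-connection is a map ${}^\star\nabla:{}^\star\mathcal{T}_U\to{}^\star\tilde{\mathcal{T}}^*_U\otimes_{\mathcal{A}_U}{}^\star\mathcal{T}_U$, ${}^\star\nabla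 V=\tilde E^k\otimes W_k$, such that the covariant derivatives ${}^\star\nabla_iV={}^\star g(E_i,\tilde E^k)\star W_k=W_i$ are $\mathbb{R}[[\hbar]]$-linear maps ${}^\star\mathcal{T}_U\to{}^\star\mathcal{T}_U$. Similarly a right quasi-connection is a map ${}^\star\tilde\nabla:{}^\star\tilde{\mathcal{T}}_U\to{}^\star\tilde{\mathcal{T}}_U\otimes_{\mathcal{A}_U}{}^\star\mathcal{T}^*_U$, ${}^\star\tilde\nabla\tilde V=\tilde W_k\otimes E^k$, with $\mathbb{R}[[\hbar]]$-linear ${}^\star\tilde\nabla_i\tilde V=\tilde W_k\star{}^\star g(E^k,\tilde E_i)=\tilde W_i$. No Leibniz rule is required. Curvature operators: ${}^\star\mathcal{R}_{E_iE_j}={}^\star\nabla_i{}^\star\nabla_j-{}^\star\nabla_j{}^\star\nabla_i$ and ${}^\star\tilde{\mathcal{R}}_{\tilde E_i\tilde E_j}={}^\star\tilde\nabla_i{}^\star\tilde\nabla_j-{}^\star\tilde\nabla_j{}^\star\tilde\nabla_i$. *)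

(* Defs.v *)
From HB Require Import structures.
From mathcomp Require Import all_boot all_order all_algebra generic_quotient.
From mathcomp Require Import boolp classical_sets functions reals topology
  normedtype derive.

Set Implicit Arguments.
Unset Strict Implicit.
Unset Printing Implicit Defensive.

Import Order.TTheory GRing.Theory Num.Theory numFieldNormedType.Exports.

Local Open Scope classical_set_scope.
Local Open Scope ring_scope.
Local Open Scope quotient_scope.

(* A coordinate chart is identified, through its coordinates x^1, ..., x^n,
   with an open subset of R^n. *)
Record chart (R : realType) (n : nat) := Chart {
  chart_set :> set 'rV[R]_n;
  chart_open : open chart_set
}.

Section SmoothFunctions.
Context {R : realType} {n : nat}.
Implicit Types (U : chart R n) (f g : 'rV[R]_n -> R) (i : 'I_n).

Definition pderiv i f : 'rV[R]_n -> R := fun x => 'D_(delta_mx 0 i) f x.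

(* f is of class C^k at all points of U; its values off U are irrelevant *)
Fixpoint Ck (U : set 'rV[R]_n) (k : nat) f : Prop :=
  (forall x, U x -> {for x, continuous f}) /\
  if k is k'.+1 then
    forall i, (forall x, U x -> derivable f x (delta_mx 0 i)) /\
              Ck U k' (pderiv i f)
  else True.

(* extension by 0 of a function on U *)
Definition ext U (u : U -> R) : 'rV[R]_n -> R :=
  fun x => oapp u 0 (insub x).

Definition smooth U : {pred U -> R} := fun u => `[< forall k, Ck U k (ext u) >].

Lemma ext_val U (u : U -> R) (x : U) : ext u (val x) = u x.
Proof. by rewrite /ext valK. Qed.

Lemma ext_in U (u : U -> R) (h : 'rV[R]_n -> R) x : chart_set U x ->
  (forall y : U, u y = h (val y)) -> ext u x = h x.
Proof.
move=> Ux uh; have xU : x \in (U : set _) by rewrite inE.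
by rewrite -[x in RHS]/(val (exist _ x xU : U)) -uh -ext_val.
Qed.

Lemma chart_near U x : chart_set U x -> \forall y \near x, chart_set U y.
Proof. by move=> Ux; apply: open_nbhs_nbhs; split => //; exact: chart_open. Qed.

Lemma chart_near_eq U f g x : (forall y, chart_set U y -> f y = g y) ->
  chart_set U x -> {near x, f =1 g}.
Proof. by move=> fg /chart_near; apply: filterS. Qed.

Lemma chart_near_continuous U f g x :
  (forall y, chart_set U y -> f y = g y) -> chart_set U x ->
  {for x, continuous f} -> {for x, continuous g}.
Proof.
move=> fg Ux; rewrite /prop_for /continuous_at -fg//; apply: cvg_trans.
exact: (@near_eq_cvg _ _ (nbhs x) _ f g (chart_near_eq fg Ux)).
Qed.

Lemma Ck_eq U k f g :
  (forall x, chart_set U x -> f x = g x) -> Ck U k f -> Ck U k g.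
Proof.
elim: k f g => [|k IH] f g fg [cf df].
  by split=> // x Ux; exact: chart_near_continuous fg Ux (cf x Ux).
split=> [x Ux|i]; first exact: chart_near_continuous fg Ux (cf x Ux).
have [dfi Cfi] := df i; split=> [x Ux|].
  exact: near_eq_derivable (chart_near_eq fg Ux) (dfi x Ux).
by apply: IH Cfi => x Ux; apply: near_eq_derive; exact: chart_near_eq fg Ux.
Qed.

Lemma Ck_S U k f : Ck U k.+1 f -> Ck U k f.
Proof.
elim: k f => [|k IH] f [cf df]; split=> // i.
by have [dfi Cfi] := df i; split=> //; apply: IH.
Qed.

Lemma Ck_cst U k (a : R) : Ck U k (cst a).
Proof.
elim: k a => [|k IH] a; split=> //; try by move=> x _; exact: cst_continuous.
move=> i; split=> [x _|]; first exact: derivable_cst.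
by apply: Ck_eq (IH 0) => x _; rewrite /pderiv derive_cst.
Qed.

Lemma Ck_add U k f g : Ck U k f -> Ck U k g -> Ck U k (f + g).
Proof.
elim: k f g => [|k IH] f g [cf df] [cg dg].
  by split=> // x Ux; apply: continuousD; [exact: cf|exact: cg].
split=> [x Ux|i]; first by apply: continuousD; [exact: cf|exact: cg].
have [dfi Cfi] := df i; have [dgi Cgi] := dg i; split=> [x Ux|].
  by apply: derivableD; [exact: dfi|exact: dgi].
by apply: Ck_eq (IH _ _ Cfi Cgi) => x Ux; rewrite /pderiv deriveD//; auto.
Qed.

Lemma Ck_mul U k f g : Ck U k f -> Ck U k g -> Ck U k (f * g).
Proof.
elim: k f g => [|k IH] f g Cf Cg; have [cf df] := Cf; have [cg dg] := Cg.
  by split=> // x Ux; apply: continuousM; [exact: cf|exact: cg].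
split=> [x Ux|i]; first by apply: continuousM; [exact: cf|exact: cg].
have [dfi Cfi] := df i; have [dgi Cgi] := dg i; split=> [x Ux|].
  by apply: derivableM; [exact: dfi|exact: dgi].
apply: Ck_eq (Ck_add (IH _ _ (Ck_S Cf) Cgi) (IH _ _ (Ck_S Cg) Cfi)) => x Ux.
by rewrite /pderiv deriveM//; auto.
Qed.

Lemma smooth_subalg U : subsemimod_closed (@smooth U) /\ subring_closed (@smooth U).
Proof.
have s0 : (0 : U -> R) \in @smooth U.
  apply/asboolP => k; apply: Ck_eq (Ck_cst U k 0) => x Ux.
  by apply/esym; apply: (ext_in (h := cst 0)) Ux _.
have s1 : (1 : U -> R) \in @smooth U.
  apply/asboolP => k; apply: Ck_eq (Ck_cst U k 1) => x Ux.
  by apply/esym; apply: (ext_in (h := cst 1)) Ux _.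
have sD : {in @smooth U &, forall u v, u + v \in @smooth U}.
  move=> u v /asboolP su /asboolP sv; apply/asboolP => k.
  apply: Ck_eq (Ck_add (su k) (sv k)) => x Ux.
  by apply/esym; apply: (ext_in Ux) => y; rewrite !fctE !ext_val.
have sM : {in @smooth U &, forall u v, u * v \in @smooth U}.
  move=> u v /asboolP su /asboolP sv; apply/asboolP => k.
  apply: Ck_eq (Ck_mul (su k) (sv k)) => x Ux.
  by apply/esym; apply: (ext_in Ux) => y; rewrite !fctE !ext_val.
have sZ : forall a : R, {in @smooth U, forall u, a *: u \in @smooth U}.
  move=> a u /asboolP su; apply/asboolP => k.
  apply: Ck_eq (Ck_mul (Ck_cst U k a) (su k)) => x Ux.
  by apply/esym; apply: (ext_in Ux) => y; rewrite !fctE ext_val.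
split; split=> //.
by move=> u v su sv; rewrite -[- v]scaleN1r; apply: sD => //; apply: sZ.
Qed.

Definition Cinf U := {u : U -> R | u \in @smooth U}.

HB.instance Definition _ U := [isSub of Cinf U for sval].
HB.instance Definition _ U := [Choice of Cinf U by <:].
HB.instance Definition _ U :=
  GRing.SubChoice_isSubComPzRing.Build _ _ (Cinf U) (smooth_subalg U).2.
HB.instance Definition _ U :=
  GRing.SubZmodule_isSubLmodule.Build _ _ _ (Cinf U) (smooth_subalg U).1.

Lemma dpart_subproof U i (u : Cinf U) :
  (fun x : U => pderiv i (ext (val u)) (val x)) \in @smooth U.
Proof.
apply/asboolP => k; have /asboolP/(_ k.+1)[_ /(_ i)[_]] := valP u.
by apply: Ck_eq => x Ux; apply/esym; apply: ext_in Ux _.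
Qed.

Definition dpart U i (u : Cinf U) : Cinf U :=
  exist (fun v => v \in @smooth U) _ (dpart_subproof i u).

(* al is a multi-index whose entries are at most N *)
Definition dmulti U N (al : {ffun 'I_n -> 'I_N.+1}) (u : Cinf U) : Cinf U :=
  foldr (fun i v => iter (al i) (@dpart U i) v) u (enum 'I_n).

Definition bidifferential U (B : Cinf U -> Cinf U -> Cinf U) : Prop :=
  exists N (b : {ffun 'I_n -> 'I_N.+1} -> {ffun 'I_n -> 'I_N.+1} -> Cinf U),
    forall u v, B u v = \sum_al \sum_be b al be * dmulti al u * dmulti be v.

End SmoothFunctions.

Definition fps (A : Type) : Type := nat -> A.

Definition cauchy (A B : Type) (C : nmodType) (op : A -> B -> C)
    (a : fps A) (b : fps B) : fps C :=
  fun k => \sum_(i < k.+1) op (a i) (b (k - i)%N).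

Definition fpsC (V : nmodType) (v : V) : fps V := fun k => if k is 0 then v else 0.

HB.instance Definition _ (V : zmodType) :=
  GRing.Zmodule.copy (fps V) (nat -> V).

Lemma fpsD (V : zmodType) (u v : fps V) k : (u + v) k = u k + v k.
Proof. by []. Qed.

Lemma cauchyA (A B C : Type) (D X Y : nmodType)
    (op1 : A -> X -> D) (op2 : B -> C -> X) (op3 : Y -> C -> D)
    (op4 : A -> B -> Y) :
  (forall a, op1 a 0 = 0) -> (forall a, {morph op1 a : x y / x + y}) ->
  (forall c, op3 0 c = 0) -> (forall c, {morph op3^~ c : x y / x + y}) ->
  (forall a b c, op1 a (op2 b c) = op3 (op4 a b) c) ->
  forall a b c, cauchy op1 a (cauchy op2 b c) = cauchy op3 (cauchy op4 a b) c.
Proof.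
move=> op10 op1D op30 op3D opA a b c; apply/funext => k; rewrite /cauchy.
pose F i m := op1 (a i) (op2 (b (m - i)%N) (c (k - m)%N)).
transitivity (\sum_(i < k.+1) \sum_(m < k.+1 | (i <= m)%N) F i m).
  apply: eq_bigr => i _; rewrite (big_morph _ (op1D _) (op10 _)).
  rewrite -(big_geq_mkord _ _ xpredT (F i)) -[X in \sum_(X <= _ < _) _]add0n.
  rewrite big_addn big_mkord (subSn (leq_ord i)); apply: eq_bigr => j _.
  by rewrite /F addnK addnC subnDA.
rewrite (exchange_big_dep xpredT)//=; apply: eq_bigr => m _.
rewrite (big_morph _ (op3D _) (op30 _)).
rewrite (big_ord_widen k.+1 (fun i => op3 (op4 (a i) (b (m - i)%N)) _))//.
by apply: eq_big => [i|i _]; rewrite ?ltnS// -opA.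
Qed.

Lemma cauchyC (A B : Type) (C : nmodType) (op : A -> B -> C)
    (op' : B -> A -> C) : (forall a b, op a b = op' b a) ->
  forall a b, cauchy op a b = cauchy op' b a.
Proof.
move=> opC a b; apply/funext => k.
rewrite /cauchy [RHS](reindex_inj rev_ord_inj); apply: eq_bigr => i _.
by rewrite /= subSS subKn ?leq_ord.
Qed.

Section FormalPowerSeries.
Variable R : comPzRingType.

Definition fps_mul : fps R -> fps R -> fps R := cauchy *%R.

Fact fps_mulA : associative fps_mul.
Proof.
move=> a b c; apply: (@cauchyA _ _ _ R R R *%R *%R *%R *%R) => {a b c}.
- exact: mulr0.
- exact: mulrDr.
- exact: mul0r.
- by move=> c x y; rewrite mulrDl.
- exact: mulrA.
Qed.

Fact fps_mulC : commutative fps_mul.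
Proof. exact: cauchyC (@mulrC R). Qed.

Fact fps_mul1r : left_id (fpsC 1) fps_mul.
Proof.
move=> a; apply/funext => k; rewrite /fps_mul /cauchy big_ord_recl /= mul1r.
by rewrite subn0 big1 ?addr0// => i _; rewrite mul0r.
Qed.

Fact fps_mulDl : left_distributive fps_mul +%R.
Proof.
move=> a b c; apply/funext => k; rewrite [RHS]fpsD /fps_mul /cauchy -big_split.
by apply: eq_bigr => i _; rewrite fpsD mulrDl.
Qed.

HB.instance Definition _ := GRing.Zmodule_isComPzRing.Build (fps R)
  fps_mulA fps_mulC fps_mul1r fps_mulDl.

Variable V : lmodType R.

Definition fps_scale : fps R -> fps V -> fps V := cauchy *:%R.

Fact fps_scaleA a b v : fps_scale a (fps_scale b v) = fps_scale (a * b) v.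
Proof.
apply: (@cauchyA _ _ _ V V R *:%R *:%R *:%R *%R) => {a b v}.
- exact: scaler0.
- exact: scalerDr.
- exact: scale0r.
- by move=> c x y; rewrite scalerDl.
- exact: scalerA.
Qed.

Fact fps_scale1r : left_id 1 fps_scale.
Proof.
move=> v; apply/funext => k; rewrite /fps_scale /cauchy big_ord_recl /= scale1r.
by rewrite subn0 big1 ?addr0// => i _; rewrite scale0r.
Qed.

Fact fps_scaleDr : right_distributive fps_scale +%R.
Proof.
move=> a u v; apply/funext => k; rewrite [RHS]fpsD /fps_scale /cauchy -big_split.
by apply: eq_bigr => i _; rewrite fpsD scalerDr.
Qed.

Fact fps_scaleDl v : {morph fps_scale^~ v : a b / a + b}.
Proof.
move=> a b; apply/funext => k; rewrite [RHS]fpsD /fps_scale /cauchy -big_split.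
by apply: eq_bigr => i _; rewrite fpsD scalerDl.
Qed.

HB.instance Definition _ := GRing.Zmodule_isLmodule.Build (fps R) (fps V)
  fps_scaleA fps_scale1r fps_scaleDr fps_scaleDl.

Definition hbar : fps R := fun k => (k == 1%N)%:R.

Lemma hbar_scale (u : fps V) :
  hbar *: u = (fun k => if k is k'.+1 then u k' else 0).
Proof.
apply/funext => -[|k]; rewrite [LHS]/GRing.scale /= /fps_scale /cauchy.
  by rewrite big_ord1 /hbar scale0r.
rewrite 2!big_ord_recl /hbar /= scale0r add0r scale1r subSS subn0.
by rewrite big1 ?addr0// => i _; rewrite scale0r.
Qed.

Lemma fps_decomp (u : fps V) : u = hbar *: ((fun k => u k.+1) : fps V) + fpsC (u 0).
Proof.
by apply/funext => k; rewrite fpsD hbar_scale; case: k => [|k] /=;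
  rewrite ?add0r ?addr0.
Qed.

End FormalPowerSeries.

(* R[[hbar]]-linear maps are hbar-adically continuous. *)
Lemma fps_linear_ext (R : comPzRingType) (V W : lmodType R)
    (f g : fps V -> fps W) :
  (forall a u v, f (a *: u + v) = a *: f u + f v) ->
  (forall a u v, g (a *: u + v) = a *: g u + g v) ->
  (forall v, f (fpsC v) = g (fpsC v)) -> f =1 g.
Proof.
move=> lf lg fg u; apply/funext => k.
elim: k u => [|k IH] u; rewrite (fps_decomp u) lf lg fg !fpsD.
  by rewrite !hbar_scale.
by rewrite !hbar_scale IH.
Qed.


Section StarProduct.
Context {R : realType} {n : nat}.

Record star_product (U : chart R n) := StarProduct {
  star : fps (Cinf U) -> fps (Cinf U) -> fps (Cinf U);
  starA : associative star;
  star_linearl : forall (a : fps R) u v w,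
    star (a *: u + v) w = a *: star u w + star v w;
  star_linearr : forall (a : fps R) u v w,
    star w (a *: u + v) = a *: star w u + star w v;
  star1l : forall u : Cinf U, star (fpsC 1) (fpsC u) = fpsC u;
  star1r : forall u : Cinf U, star (fpsC u) (fpsC 1) = fpsC u;
  star_deform : exists B : nat -> Cinf U -> Cinf U -> Cinf U,
    (forall q, (0 < q)%N -> bidifferential (B q)) /\
    forall u v, star (fpsC u) (fpsC v) =
      (fun q => if q == 0%N then u * v else B q u v)
}.

Variables (U : chart R n) (s : star_product U).

(* A_U = C^oo(U)[[hbar]] with the product star; fps (Cinf U) itself carries the
   R[[hbar]]-bilinear extension of the pointwise product. *)
Definition starAlg (s : star_product U) : Type := fps (Cinf U).

HB.instance Definition _ := GRing.Lmodule.copy (starAlg s) (fps (Cinf U)).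

Fact star_mul1r : left_id (fpsC 1 : starAlg s) (star s).
Proof.
apply: (fps_linear_ext (fun a u v => star_linearr s a u v (fpsC 1))) (@star1l _ s) => //.
Qed.

Fact star_mulr1 : right_id (fpsC 1 : starAlg s) (star s).
Proof.
apply: (fps_linear_ext (fun a u v => star_linearl s a u v (fpsC 1))) (@star1r _ s) => //.
Qed.

Fact star_mulDl : left_distributive (star s) (+%R : starAlg s -> _).
Proof.
move=> u v w; rewrite -[u]scale1r (star_linearl s 1 u v w).
by rewrite !scale1r.
Qed.

Fact star_mulDr : right_distributive (star s) (+%R : starAlg s -> _).
Proof.
move=> w u v; rewrite -[u]scale1r (star_linearr s 1 u v w).
by rewrite !scale1r.
Qed.

HB.instance Definition _ := GRing.Zmodule_isPzRing.Build (starAlg s)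
  (@starA _ s) star_mul1r star_mulr1 star_mulDl star_mulDr.

Lemma star_scalel c (a b : starAlg s) : (c *: a) * b = c *: (a * b).
Proof.
have E : c *: a * b = c *: (a * b) + 0 * b.
  by rewrite -[c *: a]addr0; exact: star_linearl.
by rewrite E mul0r addr0.
Qed.

Lemma star_scaler c (a b : starAlg s) : a * (c *: b) = c *: (a * b).
Proof.
have E : a * (c *: b) = c *: (a * b) + a * 0.
  by rewrite -[c *: b]addr0; exact: star_linearr.
by rewrite E mulr0 addr0.
Qed.

End StarProduct.

(* The tensor product M (x)_K N of a right K-module M and a left K-module N
   (with actions ra and la): the free abelian monoid on M * N modulo the
   relations generated by tensor_eq. It is a group, the opposite of the class
   of (x, y) being the class of (- x, y). *)
Section Tensor.
Context {K : Type} {M N : zmodType}.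
Variables (ra : M -> K -> M) (la : K -> N -> N).

Inductive tensor_eq : seq (M * N) -> seq (M * N) -> Prop :=
| TensorRefl s : tensor_eq s s
| TensorSym s t : tensor_eq s t -> tensor_eq t s
| TensorTrans s t r : tensor_eq s t -> tensor_eq t r -> tensor_eq s r
| TensorCat s s' t t' :
    tensor_eq s s' -> tensor_eq t t' -> tensor_eq (s ++ t) (s' ++ t')
| TensorPerm s t : perm_eq s t -> tensor_eq s t
| TensorZero y : tensor_eq [:: (0, y)] [::]
| TensorAddl x x' y : tensor_eq [:: (x + x', y)] [:: (x, y); (x', y)]
| TensorAddr x y y' : tensor_eq [:: (x, y + y')] [:: (x, y); (x, y')]
| TensorBal x k y : tensor_eq [:: (ra x k, y)] [:: (x, la k y)].

Definition tensor_rel : rel (seq (M * N)) := fun s t => `[< tensor_eq s t >].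

Fact tensor_rel_equiv : equiv_class_of tensor_rel.
Proof.
split=> [s|s t|t s r]; first exact/asboolP/TensorRefl.
  by apply/asboolP/asboolP; exact: TensorSym.
by move=> /asboolP st /asboolP tr; apply/asboolP; exact: TensorTrans st tr.
Qed.

Canonical tensor_equiv := EquivRelPack tensor_rel_equiv.

Definition tensor : Type := {eq_quot tensor_equiv}.

HB.instance Definition _ := Choice.on tensor.
HB.instance Definition _ := EqQuotient.on tensor.

Definition tclass (s : seq (M * N)) : tensor := \pi_tensor s.

Lemma tclassP s t : tclass s = tclass t <-> tensor_eq s t.
Proof.
rewrite /tclass; split=> [/eqquotP/asboolP//|st].
by apply/eqquotP/asboolP.
Qed.

Lemma tclass_repr t : tclass (repr t) = t.
Proof. exact: reprK. Qed.

Definition tadd (t u : tensor) : tensor := tclass (repr t ++ repr u).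
Definition topp (t : tensor) : tensor :=
  tclass [seq (- p.1, p.2) | p <- repr t].

Lemma tensor_opp s : tensor_eq ([seq (- p.1, p.2) | p <- s] ++ s) [::].
Proof.
elim: s => [|[x y] s IH] /=; first exact: TensorRefl.
apply: (@TensorTrans _ ([:: (- x, y); (x, y)] ++
  ([seq (- p.1, p.2) | p <- s] ++ s))).
  apply: TensorPerm; rewrite /= perm_cons.
  by rewrite -[_ :: s]cat1s perm_catCA.
rewrite -[[::]]cats0; apply: TensorCat IH.
apply: TensorTrans (TensorSym (TensorAddl _ _ _)) _.
by rewrite addNr; exact: TensorZero.
Qed.

Lemma tadd_class s t : tadd (tclass s) (tclass t) = tclass (s ++ t).
Proof.
by apply/tclassP; apply: TensorCat; apply/tclassP; exact: tclass_repr.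
Qed.

Fact taddA : associative tadd.
Proof.
move=> t u v; rewrite -[t]tclass_repr -[u]tclass_repr -[v]tclass_repr.
by rewrite !tadd_class catA.
Qed.

Fact taddC : commutative tadd.
Proof.
move=> t u; apply/tclassP/TensorPerm; exact: permEl (perm_catC _ _).
Qed.

Fact tadd0 : left_id (tclass [::]) tadd.
Proof. by move=> t; rewrite -[t]tclass_repr tadd_class. Qed.

Fact taddN : left_inverse (tclass [::]) topp tadd.
Proof.
move=> t; rewrite -{2}[t]tclass_repr tadd_class.
exact/tclassP/tensor_opp.
Qed.

HB.instance Definition _ := GRing.isZmodule.Build tensor taddA taddC tadd0 taddN.

Definition tpure (x : M) (y : N) : tensor := tclass [:: (x, y)].

Lemma tclassD s t : tclass (s ++ t) = tclass s + tclass t.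
Proof. by rewrite -tadd_class. Qed.

Lemma tclass_sum s : tclass s = \sum_(p <- s) tpure p.1 p.2.
Proof.
by elim: s => [|[x y] s IH]; rewrite ?big_nil// big_cons -IH -tclassD.
Qed.

Lemma tpureDl x x' y : tpure (x + x') y = tpure x y + tpure x' y.
Proof. by rewrite -tclassD; exact/tclassP/TensorAddl. Qed.

Lemma tpureDr x y y' : tpure x (y + y') = tpure x y + tpure x y'.
Proof. by rewrite -tclassD; exact/tclassP/TensorAddr. Qed.

Lemma tpure_bal x k y : tpure (ra x k) y = tpure x (la k y).
Proof. exact/tclassP/TensorBal. Qed.

Definition balanced (Z : zmodType) (phi : M -> N -> Z) : Prop :=
  [/\ forall x x' y, phi (x + x') y = phi x y + phi x' y,
      forall x y y', phi x (y + y') = phi x y + phi x y' &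
      forall x k y, phi (ra x k) y = phi x (la k y)].

(* The additive map with x (x) y |-> phi x y; meaningful for balanced phi. *)
Definition tlift (Z : zmodType) (phi : M -> N -> Z) (t : tensor) : Z :=
  \sum_(p <- repr t) phi p.1 p.2.

Lemma tlift_class (Z : zmodType) (phi : M -> N -> Z) s : balanced phi ->
  tlift phi (tclass s) = \sum_(p <- s) phi p.1 p.2.
Proof.
case=> phiDl phiDr phiB.
have phi0 y : phi 0 y = 0.
  by apply: (addIr (phi 0 y)); rewrite -phiDl !add0r.
suff phi_eq u v : tensor_eq u v ->
    \sum_(p <- u) phi p.1 p.2 = \sum_(p <- v) phi p.1 p.2.
  by apply: phi_eq; apply/tclassP; exact: tclass_repr.
elim=> {u v} [//|//|u v w _ -> _ ->//|u u' v v' _ IHu _ IHv|u v uv|y|x x' y|x y y'|x k y].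
- by rewrite !big_cat /= IHu IHv.
- exact: perm_big.
- by rewrite big_seq1 big_nil /= phi0.
- by rewrite !big_cons !big_nil /= !addr0 phiDl.
- by rewrite !big_cons !big_nil /= !addr0 phiDr.
- by rewrite !big_seq1 /= phiB.
Qed.

Lemma tlift_pure (Z : zmodType) (phi : M -> N -> Z) x y : balanced phi ->
  tlift phi (tpure x y) = phi x y.
Proof. by move=> bphi; rewrite tlift_class// big_seq1. Qed.

Lemma tliftD (Z : zmodType) (phi : M -> N -> Z) : balanced phi ->
  {morph tlift phi : t u / t + u}.
Proof.
move=> bphi t u; rewrite -[t]tclass_repr -[u]tclass_repr -tclassD.
by rewrite !tlift_class// big_cat.
Qed.

End Tensor.

Section Bundles.
Context {R : realType} {n : nat} {U : chart R n}.
Variable s : star_product U.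
Local Notation A := (starAlg s).

(* Left (A_U, star)-modules are A-modules and right ones are A^c-modules. The
   left bundles T and T^* and the right bundles T~ and T~^* are given by the
   coordinates in their bases (E_i), (E^i), (E~_i) and (E~^i). *)
Definition tangent_l := 'rV[A]_n.
Definition tangent_r := 'rV[A^c]_n.
Definition cotangent_l := 'rV[A]_n.
Definition cotangent_r := 'rV[A^c]_n.

HB.instance Definition _ := GRing.Lmodule.on tangent_l.
HB.instance Definition _ := GRing.Lmodule.on tangent_r.
HB.instance Definition _ := GRing.Lmodule.on cotangent_l.
HB.instance Definition _ := GRing.Lmodule.on cotangent_r.

Definition El (i : 'I_n) : tangent_l := delta_mx 0 i.
Definition Er (i : 'I_n) : tangent_r := delta_mx 0 i.
Definition dEl (i : 'I_n) : cotangent_l := delta_mx 0 i.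
Definition dEr (i : 'I_n) : cotangent_r := delta_mx 0 i.

Definition ract (M : lmodType A^c) (v : M) (a : A) : M := (a : A^c) *: v.

(* R[[hbar]] acts coordinatewise; the canonical scaling of the bundles is by
   (A_U, star). *)
Definition hscale_l (c : fps R) (V : tangent_l) : tangent_l :=
  \row_j (c *: V 0 j).
Definition hscale_r (c : fps R) (V : tangent_r) : tangent_r :=
  \row_j (c *: (V 0 j : A)).

Definition tensor_h := tensor (fun (V : tangent_l) c => hscale_l c V) hscale_r.
HB.instance Definition _ := GRing.Zmodule.on tensor_h.
Definition tens_h (V : tangent_l) (W : tangent_r) : tensor_h := tpure _ _ V W.

Definition tensor_A (M : lmodType A^c) (N : lmodType A) :=
  tensor (@ract M) (fun a (W : N) => a *: W).
HB.instance Definition _ M N := GRing.Zmodule.on (tensor_A M N).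

(* a * (V (x) W) = (a * V) (x) W and (V (x) W) * a = V (x) (W * a) *)
Definition tact_l (a : A) (t : tensor_h) : tensor_h :=
  tlift (fun V W => tens_h (a *: V) W) t.
Definition tact_r (t : tensor_h) (a : A) : tensor_h :=
  tlift (fun V W => tens_h V (ract W a)) t.

Definition gram (g : tensor_h -> A) : 'M[A]_n :=
  \matrix_(i, j) g (tens_h (El i) (Er j)).

Record star_metric := StarMetric {
  metric :> tensor_h -> A;
  metricD : {morph metric : t u / t + u};
  metric_actl : forall a t, metric (tact_l a t) = a * metric t;
  metric_actr : forall t a, metric (tact_r t a) = metric t * a;
  metric_inv : exists G : 'M[A]_n,
    gram metric *m G = 1%:M /\ G *m gram metric = 1%:M
}.

Lemma hscale_lZ c a (V : tangent_l) : hscale_l c (a *: V) = a *: hscale_l c V.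
Proof. by apply/rowP => j; rewrite !mxE star_scaler. Qed.

Lemma hscale_r_ract c (W : tangent_r) a :
  hscale_r c (ract W a) = ract (hscale_r c W) a.
Proof. by apply/rowP => j; rewrite !mxE [RHS]star_scalel. Qed.

Lemma tact_l_pure a V W :
  tact_l a (tens_h V W) = tens_h (a *: V) W.
Proof.
rewrite /tact_l /tens_h tlift_pure//; split=> [x x' y|x y y'|x k y].
- by rewrite scalerDr tpureDl.
- by rewrite tpureDr.
- by rewrite -hscale_lZ tpure_bal.
Qed.

Lemma tact_r_pure a V W :
  tact_r (tens_h V W) a = tens_h V (ract W a).
Proof.
rewrite /tact_r /tens_h tlift_pure//; split=> [x x' y|x y y'|x k y].
- by rewrite tpureDl.
- by rewrite /ract scalerDr tpureDr.
- by rewrite tpure_bal hscale_r_ract.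
Qed.

Variable g : star_metric.

(* (g^{ij}), the two-sided inverse of (g_{ij}) *)
Definition ginv : 'M[A]_n := sval (cid (metric_inv g)).

(* The metric identifies T^* with T and T~^* with T~ by
   E^i = g^{ij} * E_j and E~^i = E~_j * g^{ji}; these identifications extend g
   to pairings of T with T~^* and of T^* with T~. *)
Definition sharp_l (eta : cotangent_l) : tangent_l :=
  \sum_i eta 0 i *: (\sum_j ginv i j *: El j).
Definition sharp_r (om : cotangent_r) : tangent_r :=
  \sum_i ract (\sum_j ract (Er j) (ginv j i)) (om 0 i).

Definition pair_l (V : tangent_l) (om : cotangent_r) : A :=
  g (tens_h V (sharp_r om)).
Definition pair_r (eta : cotangent_l) (W : tangent_r) : A :=
  g (tens_h (sharp_l eta) W).

Lemma metric_pureZ a V W : g (tens_h (a *: V) W) = a * g (tens_h V W).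
Proof. by rewrite -metric_actl tact_l_pure. Qed.

Lemma metric_pure_ract a V W :
  g (tens_h V (ract W a)) = g (tens_h V W) * a.
Proof. by rewrite -metric_actr tact_r_pure. Qed.

Lemma metric_pureDl V V' W :
  g (tens_h (V + V') W) = g (tens_h V W) + g (tens_h V' W).
Proof. by rewrite -metricD /tens_h -tpureDl. Qed.

Lemma metric_pureDr V W W' :
  g (tens_h V (W + W')) = g (tens_h V W) + g (tens_h V W').
Proof. by rewrite -metricD /tens_h -tpureDr. Qed.

Lemma metric_suml I (r : seq I) (F : I -> tangent_l) W :
  g (tens_h (\sum_(i <- r) F i) W) = \sum_(i <- r) g (tens_h (F i) W).
Proof.
apply: (big_morph (fun V => g (tens_h V W))) => [V V'|].
  exact: metric_pureDl.
by rewrite -(scale0r (0 : tangent_l)) metric_pureZ mul0r.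
Qed.

Lemma metric_sumr I (r : seq I) V (F : I -> tangent_r) :
  g (tens_h V (\sum_(i <- r) F i)) = \sum_(i <- r) g (tens_h V (F i)).
Proof.
apply: (big_morph (fun W => g (tens_h V W))) => [W W'|].
  exact: metric_pureDr.
have -> : (0 : tangent_r) = ract 0 0 by rewrite /ract scaler0.
by rewrite metric_pure_ract mulr0.
Qed.

Lemma sharp_lZ a eta : sharp_l (a *: eta) = a *: sharp_l eta.
Proof.
by rewrite /sharp_l scaler_sumr; apply: eq_bigr => i _; rewrite mxE scalerA.
Qed.

Lemma sharp_lD eta eta' : sharp_l (eta + eta') = sharp_l eta + sharp_l eta'.
Proof.
by rewrite /sharp_l -big_split; apply: eq_bigr => i _; rewrite mxE scalerDl.
Qed.

Lemma sharp_rZ om a : sharp_r (ract om a) = ract (sharp_r om) a.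
Proof.
rewrite /sharp_r /ract scaler_sumr; apply: eq_bigr => i _.
by rewrite mxE [RHS]scalerA.
Qed.

Lemma sharp_rD om om' : sharp_r (om + om') = sharp_r om + sharp_r om'.
Proof.
rewrite /sharp_r -big_split; apply: eq_bigr => i _.
by rewrite mxE /ract scalerDl.
Qed.

Lemma pair_l_dual i k : pair_l (El i) (dEr k) = (i == k)%:R.
Proof.
rewrite /pair_l /sharp_r metric_sumr (bigD1 k)//= [X in _ + X]big1 ?addr0 => [|j jk].
  rewrite metric_pure_ract mxE !eqxx mulr1 metric_sumr.
  have [/matrixP/(_ i k) + _] := svalP (cid (metric_inv g)).
  rewrite !mxE => <-; apply: eq_bigr => j _.
  by rewrite metric_pure_ract mxE.
by rewrite metric_pure_ract mxE (negPf jk) andbF mulr0.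
Qed.

Lemma pair_r_dual i k : pair_r (dEl k) (Er i) = (k == i)%:R.
Proof.
rewrite /pair_r /sharp_l metric_suml (bigD1 k)//= [X in _ + X]big1 ?addr0 => [|j jk].
  rewrite metric_pureZ mxE !eqxx mul1r metric_suml.
  have [_ /matrixP/(_ k i)] := svalP (cid (metric_inv g)).
  rewrite !mxE => <-; apply: eq_bigr => j _.
  by rewrite metric_pureZ mxE.
by rewrite metric_pureZ mxE (negPf jk) andbF mul0r.
Qed.

(* covariant derivatives: the contractions
   E~^k (x) W_k |-> g(E_i, E~^k) * W_k  and
   W~_k (x) E^k |-> W~_k * g(E^k, E~_i) *)
Definition cov_l (nabla : tangent_l -> tensor_A cotangent_r tangent_l)
    (i : 'I_n) (V : tangent_l) : tangent_l :=
  tlift (fun om W => pair_l (El i) om *: W) (nabla V).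
Definition cov_r (nabla : tangent_r -> tensor_A tangent_r cotangent_l)
    (i : 'I_n) (V : tangent_r) : tangent_r :=
  tlift (fun W eta => ract W (pair_r eta (Er i))) (nabla V).

Lemma balanced_l i : balanced (@ract cotangent_r) (fun a (W : tangent_l) => a *: W)
  (fun om (W : tangent_l) => pair_l (El i) om *: W).
Proof.
split=> [x x' y|x y y'|x k y].
- by rewrite /pair_l sharp_rD metric_pureDr scalerDl.
- by rewrite scalerDr.
- by rewrite /pair_l sharp_rZ metric_pure_ract scalerA.
Qed.

Lemma balanced_r i : balanced (@ract tangent_r) (fun a (eta : cotangent_l) => a *: eta)
  (fun W eta => ract W (pair_r eta (Er i))).
Proof.
split=> [x x' y|x y y'|x k y].
- by rewrite /ract scalerDr.
- by rewrite /pair_r sharp_lD metric_pureDl /ract scalerDl.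
- by rewrite /pair_r sharp_lZ metric_pureZ /ract scalerA.
Qed.

Lemma cov_lE nabla V (W : 'I_n -> tangent_l) i :
  nabla V = \sum_k tpure _ _ (dEr k) (W k) -> cov_l nabla i V = W i.
Proof.
rewrite /cov_l => ->; have bal := balanced_l i.
have -> : \sum_k tpure _ _ (dEr k) (W k) = tclass (@ract cotangent_r)
    (fun a (W : tangent_l) => a *: W) [seq (dEr k, W k) | k <- enum 'I_n].
  by rewrite tclass_sum big_map big_enum.
rewrite tlift_class// big_map big_enum (bigD1 i)//= [X in _ + X]big1 => [|k ki].
  by rewrite pair_l_dual eqxx scale1r addr0.
by rewrite pair_l_dual eq_sym (negPf ki) scale0r.
Qed.

Lemma cov_rE nabla V (W : 'I_n -> tangent_r) i :
  nabla V = \sum_k tpure _ _ (W k) (dEl k) -> cov_r nabla i V = W i.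
Proof.
rewrite /cov_r => ->; have bal := balanced_r i.
have -> : \sum_k tpure _ _ (W k) (dEl k) = tclass (@ract tangent_r)
    (fun a (eta : cotangent_l) => a *: eta) [seq (W k, dEl k) | k <- enum 'I_n].
  by rewrite tclass_sum big_map big_enum.
rewrite tlift_class// big_map big_enum (bigD1 i)//= [X in _ + X]big1 => [|k ki].
  by rewrite pair_r_dual eqxx /ract scale1r addr0.
by rewrite pair_r_dual (negPf ki) /ract scale0r.
Qed.

Record left_quasi_connection := LeftQuasiConnection {
  nabla_l :> tangent_l -> tensor_A cotangent_r tangent_l;
  nabla_l_linear : forall i (c : fps R) V W,
    cov_l nabla_l i (hscale_l c V + W) =
    hscale_l c (cov_l nabla_l i V) + cov_l nabla_l i W
}.

Record right_quasi_connection := RightQuasiConnection {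
  nabla_r :> tangent_r -> tensor_A tangent_r cotangent_l;
  nabla_r_linear : forall i (c : fps R) V W,
    cov_r nabla_r i (hscale_r c V + W) =
    hscale_r c (cov_r nabla_r i V) + cov_r nabla_r i W
}.

Definition torsion_free_l (nabla : left_quasi_connection) : Prop :=
  forall i j, cov_l nabla i (El j) = cov_l nabla j (El i).
Definition torsion_free_r (nabla : right_quasi_connection) : Prop :=
  forall i j, cov_r nabla i (Er j) = cov_r nabla j (Er i).

Definition curvature_l (nabla : left_quasi_connection) i j (V : tangent_l) :
    tangent_l :=
  cov_l nabla i (cov_l nabla j V) - cov_l nabla j (cov_l nabla i V).
Definition curvature_r (nabla : right_quasi_connection) i j (V : tangent_r) :
    tangent_r :=
  cov_r nabla i (cov_r nabla j V) - cov_r nabla j (cov_r nabla i V).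

End Bundles.

(* Main.v *)
Require Import Defs.
From mathcomp Require Import all_boot all_order all_algebra.
From mathcomp Require Import boolp classical_sets functions reals topology
  normedtype derive.

Local Open Scope ring_scope.

(* In the cyclic sum the six terms nabla_a nabla_b E_c pair off with opposite
   signs under the exchange of b and c, which torsion-freeness allows. *)
Theorem proposition6p1 (R : realType) (n : nat) (U : chart R n)
    (s : star_product U) (g : star_metric s) :
  (forall nabla : left_quasi_connection g,
     torsion_free_l nabla ->
     forall i j k : 'I_n,
       curvature_l nabla i j (El s k) + curvature_l nabla j k (El s i)
         + curvature_l nabla k i (El s j) = 0) /\
  (forall nabla : right_quasi_connection g,
     torsion_free_r nabla ->
     forall i j k : 'I_n,
       curvature_r nabla i j (Er s k) + curvature_r nabla j k (Er s i)
         + curvature_r nabla k i (Er s j) = 0).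
Proof.
split=> nabla tf i j k; rewrite /curvature_l /curvature_r.
  (* Each exchange is oriented to hit the inner derivative of one subtracted term. With a, b, c for
     nabla_i nabla_j E_k, nabla_j nabla_k E_i, nabla_k nabla_i E_j, the sum becomes (a - b) + (b -
     c) + (c - a), which telescopes. *)
  rewrite (tf i k) (tf j i) (tf k j).
  by rewrite !GRing.subrKA GRing.subrr.
(* The cancellation takes place in the additive group of the bundle, so the same three exchanges
   serve for the right module. *)
rewrite (tf i k) (tf j i) (tf k j).
by rewrite !GRing.subrKA GRing.subrr.
Qed.
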